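(* Let $R$ be an associative ring with unity and let $\mathbf{K}=(K,\leq_p)$ be an abstract elementary class with $K$ a class of left $R$-modules, such that $K$ is closed under direct sums and under pure-injective envelopes (if $M\in K$ then $PE(M)\in K$). Let $\lambda\geq \operatorname{LS}(\mathbf{K})$ be a cardinal with $\lambda^{|R|+\aleph_0}=\lambda$. Then $\mathbf{K}$ is $\lambda$-stable.
   Context: Modules are left $R$-modules in the language $\{0,+,-\}\cup\{r\cdot : r\in R\}$. A pp-formula is an existentially quantified finite system of linear equations. $M\leq_p N$ ($M$ is a pure submodule of $N$) means $M$ is a submodule of $N$ and every pp-formula with parameters in $M$ that holds in $N$ holds in $M$. A module $M$ is pure-injective if it is a direct summand of every module containing it as a pure submodule; $PE(M)$, the pure-injective envelope, is a pure-injective module containing $M$ as a pure submodule and minimal with this property. An abstract elementary class (AEC) $(K,\leq_p)$ here means: $K$ is closed under isomorphisms, $\leq_p$ restricted to $K$ is closed under unions of increasing chains (the union of a $\leq_p$-chain of members of $K$ is in $K$ and each member is pure in it), and there is a least infinite cardinal $\operatorname{LS}(\mathbf{K})$ such that for every $N\in K$ and $A\subseteq N$ there is $M\in K$ with $A\subseteq M\leq_p N$ and $|M|\leq |A|+\operatorname{LS}(\mathbf{K})$. Galois types: for $N\in K$, $A\subseteq N$ and $b\in N$, $\mathbf{gtp}(b/A;N)$ is the equivalence class of $(b,A,N)$ under the transitive closure of the relation $(b_1,A,N_1)E(b_2,A,N_2)$ iff there are $N'\in K$ and pure embeddings $f_\ell:N_\ell\to N'$ fixing $A$ pointwise with $f_1(b_1)=f_2(b_2)$.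 For $M\in K$, $\mathbf{gS}(M)=\{\mathbf{gtp}(b/M;N): M\leq_p N\in K, b\in N\}$. $\mathbf{K}$ is $\lambda$-stable if $|\mathbf{gS}(M)|\leq\lambda$ for every $M\in K$ of cardinality $\lambda$. *)

(* Defs.v *)
From HB Require Import structures.
From mathcomp Require Import all_boot all_algebra.
From Stdlib Require Import Relations List.
Set Implicit Arguments.
Unset Strict Implicit.
Unset Printing Implicit Defensive.
Import GRing.Theory.
Local Open Scope ring_scope.

Section Modules.
Variable R : pzRingType.

Definition lin (M N : lmodType R) (f : M -> N) : Prop :=
  forall (r : R) (x y : M), f (r *: x + y) = r *: f x + f y.

(* Every pp-formula with parameters from M (a finite system of m linear
   equations  sum_j A_ij y_j + sum_l B_il a_l = 0  in n existentially
   quantified unknowns y and k parameters a) that holds in N (parameters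
   transported by f) already holds in M. *)
Definition pp_reflecting (M N : lmodType R) (f : M -> N) : Prop :=
  forall (m n k : nat) (A : 'I_m -> 'I_n -> R) (B : 'I_m -> 'I_k -> R)
         (a : 'I_k -> M),
    (exists y : 'I_n -> N, forall i : 'I_m,
        \sum_(j < n) A i j *: y j + \sum_(l < k) B i l *: f (a l) = 0) ->
    (exists y : 'I_n -> M, forall i : 'I_m,
        \sum_(j < n) A i j *: y j + \sum_(l < k) B i l *: a l = 0).

Definition pure_emb (M N : lmodType R) (f : M -> N) : Prop :=
  lin f /\ injective f /\ pp_reflecting f.

Definition direct_summand (P N : lmodType R) (e : P -> N) : Prop :=
  exists C : N -> Prop,
    C 0 /\ (forall (r : R) (x y : N), C x -> C y -> C (r *: x + y)) /\
    (forall n : N, exists (p : P) (c : N), C c /\ n = e p + c) /\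
    (forall p : P, C (e p) -> e p = 0).

Definition pure_injective (P : lmodType R) : Prop :=
  forall (N : lmodType R) (e : P -> N), pure_emb e -> direct_summand e.

Definition is_PE (M P : lmodType R) (e : M -> P) : Prop :=
  pure_emb e /\ pure_injective P /\
  forall (P' : lmodType R) (e' : M -> P') (h : P' -> P),
    pure_emb e' -> pure_injective P' -> lin h -> injective h ->
    (forall x : M, h (e' x) = e x) ->
    forall p : P, exists q : P', h q = p.

Definition iso_closed (K : lmodType R -> Prop) : Prop :=
  forall (M N : lmodType R) (f : M -> N), lin f -> bijective f -> K M -> K N.

(* Union of a well-ordered <=_p-chain (M_i)_{i in I} of members of K,
   realised inside N via injective linear maps g_i whose union of images
   is N: N is in K and each member is pure in N. *)
Definition chain_closed (K : lmodType R -> Prop) : Prop :=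
  forall (I : Type) (lt : I -> I -> Prop),
    well_founded lt -> (forall i j k, lt i j -> lt j k -> lt i k) ->
    (forall i j, lt i j \/ i = j \/ lt j i) ->
    forall (Mi : I -> lmodType R) (N : lmodType R) (g : forall i, Mi i -> N),
      (forall i, K (Mi i)) ->
      (forall i, lin (g i) /\ injective (g i)) ->
      (forall i j, lt i j -> exists h : Mi i -> Mi j,
          pure_emb h /\ forall x, g j (h x) = g i x) ->
      (forall n : N, exists i (x : Mi i), g i x = n) ->
      K N /\ forall i, pure_emb (g i).

Definition LS_property (K : lmodType R -> Prop) (Mu : Type) : Prop :=
  forall (N : lmodType R) (A : N -> Prop), K N ->
    exists (M : lmodType R) (g : M -> N),
      K M /\ pure_emb g /\ (forall x, A x -> exists m, g m = x) /\
      exists c : M -> ({x : N | A x} + Mu)%type, injective c.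

Definition infinite_type (T : Type) : Prop :=
  exists c : nat -> T, injective c.

Definition is_direct_sum (I : Type) (Mi : I -> lmodType R) (D : lmodType R)
    (iota : forall i, Mi i -> D) : Prop :=
  (forall i, lin (iota i)) /\
  (forall d : D, exists (s : list I) (x : forall i, Mi i),
      d = \sum_(i <- s) iota i (x i)) /\
  (forall (s : list I) (x : forall i, Mi i), Stdlib.Lists.List.NoDup s ->
      \sum_(i <- s) iota i (x i) = 0 -> forall i, Stdlib.Lists.List.In i s -> x i = 0).

Definition dsum_closed (K : lmodType R -> Prop) : Prop :=
  forall (I : Type) (Mi : I -> lmodType R) (D : lmodType R)
         (iota : forall i, Mi i -> D),
    (forall i, K (Mi i)) -> is_direct_sum iota -> K D.

Definition PE_closed (K : lmodType R -> Prop) : Prop :=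
  forall (M P : lmodType R) (e : M -> P), K M -> is_PE e -> K P.

(* a triple (b, A, N) with A the carrier of M, embedded as a subset of N
   via the injection gf *)
Record gtriple (A : Type) := GTriple {
  gN : lmodType R;
  gf : A -> gN;
  gb : gN }.

Definition gvalid (K : lmodType R -> Prop) (A : Type) (t : gtriple A) : Prop :=
  K (gN t) /\ injective (gf t).

Definition gtpE (K : lmodType R -> Prop) (A : Type) (t1 t2 : gtriple A)
  : Prop :=
  gvalid K t1 /\ gvalid K t2 /\
  exists (N' : lmodType R) (g1 : gN t1 -> N') (g2 : gN t2 -> N'),
    K N' /\ pure_emb g1 /\ pure_emb g2 /\
    (forall a : A, g1 (gf t1 a) = g2 (gf t2 a)) /\ g1 (gb t1) = g2 (gb t2).

Definition gtp_eq (K : lmodType R -> Prop) (A : Type) : relation (gtriple A) :=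
  clos_trans (gtriple A) (@gtpE K A).

(* |gS(M)| <= |L| : there is a map from the triples representing elements
   of gS(M) to L that is injective on Galois types *)
Definition gS_card_le (K : lmodType R -> Prop) (M : lmodType R) (L : Type)
  : Prop :=
  exists c : gtriple M -> L,
    forall t1 t2 : gtriple M,
      K (gN t1) -> pure_emb (gf t1) -> K (gN t2) -> pure_emb (gf t2) ->
      c t1 = c t2 -> gtp_eq K t1 t2.

Definition stable (K : lmodType R -> Prop) (L : Type) : Prop :=
  forall M : lmodType R, K M -> (exists h : M -> L, bijective h) ->
    gS_card_le K M L.

End Modules.

(* Main.v *)
(* Galois types over M are determined by pp-types, and these can be counted. If phi(b, w') holds, then phi(b, w) holds iff phi(0, w' - w) does,
   and by purity this is decided in M; so a pp-type over M is determined by one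
   instance of each pp-formula, which gives at most
   lambda^(|R| + aleph_0) = lambda of them.
   If (b1, N1) and (b2, N2) have the same pp-type over M, pure-injectivity of
   P_i = PE(N_i) gives homomorphisms f : P1 -> P2 and g : P2 -> P1 over M exchanging
   b1 and b2; then x |-> (x - g (f x), f x) and y |-> (0, y) embed P1 and P2 as
   direct summands of the sum of P1 and P2, and they agree on M and on the b_i.
   To apply the closure hypothesis one needs PE(M) to exist. The character
   bidual of M is algebraically compact and contains M purely. In it, call B small
   over M if all endomorphisms over M reflect pp-formulas on B; a maximal small B
   turns out to be the image of an idempotent endomorphism, and it is PE(M). *)
Require Import Defs.
From HB Require Import structures.
From mathcomp Require Import all_boot all_algebra algC cyclotomic.
From mathcomp Require Import boolp classical_sets functions.
Set Implicit Arguments.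
Unset Strict Implicit.
Unset Printing Implicit Defensive.
Import GRing.Theory Num.Theory.
Local Open Scope ring_scope.

(** * Characters of abelian groups *)

(** Zorn's lemma applied to the sets whose union with [A0] satisfies [P]. The empty chain is then
    covered by [P A0], so only nonempty chains need a bound in [P]. *)
Lemma zorn_above T (P : set (set T)) (A0 : set T) :
  P A0 ->
  (forall F : set (set T), (F !=set0)%classic -> (F `<=` P)%classic -> total_on F subset ->
     P (\bigcup_(X in F) X)%classic) ->
  exists A, [/\ P A, (A0 `<=` A)%classic &
    forall B, (A `<=` B)%classic -> P B -> (B `<=` A)%classic].
Proof.
move=> PA0 Pchain.
have [|A [PA maxA]] := @Zorn_bigcup T (fun A => P (A `|` A0)%classic).
  move=> F FP Ftot; have [->|/set0P [X0 FX0]] := eqVneq F set0.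
    by rewrite bigcup_set0 set0U.
  suff -> : ((\bigcup_(X in F) X) `|` A0 =
      \bigcup_(Y in [set X `|` A0 | X in F]) Y)%classic.
    apply: Pchain.
    - by exists (X0 `|` A0)%classic; exists X0.
    - by move=> _ [X FX <-]; exact: FP.
    - move=> _ _ [X FX <-] [Y FY <-].
      by case: (Ftot X Y FX FY) => h; [left|right]; exact: setSU.
  rewrite eqEsubset; split=> x.
    by case=> [[X FX Xx]|A0x];
      [exists (X `|` A0)%classic; [exists X|left]
      |exists (X0 `|` A0)%classic; [exists X0|right]].
  by case=> _ [X FX <-] [Xx|A0x]; [left; exists X|right].
exists (A `|` A0)%classic; split=> // B AB PB x Bx; left.
have [|nAx] := pselect (A x) => //; case: (maxA B); last first.
  by rewrite (_ : (B `|` A0)%classic = B) //; apply/setUidPl => y A0y; apply: AB; right.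
split; first by move=> y Ay; apply: AB; left.
by move=> /(_ x Bx).
Qed.

(* The divisible cogenerator Q/Z is replaced by the multiplicative group of
   algC, written additively. *)
Record circ := Circ { cval : algC; cvalP : cval != 0 }.
HB.instance Definition _ := [isSub for cval].
HB.instance Definition _ := [Choice of circ by <:].

Definition circ0 := Circ (oner_neq0 algC).
Definition circ_add (s t : circ) := Circ (mulf_neq0 (cvalP s) (cvalP t)).
Definition circ_opp (s : circ) := Circ (invr_neq0 (cvalP s)).

Fact circ_addA : associative circ_add.
Proof. by move=> s t u; apply: val_inj; exact: mulrA. Qed.
Fact circ_addC : commutative circ_add.
Proof. by move=> s t; apply: val_inj; exact: mulrC. Qed.
Fact circ_add0 : left_id circ0 circ_add.
Proof. by move=> s; apply: val_inj; exact: mul1r. Qed.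
Fact circ_addN : left_inverse circ0 circ_opp circ_add.
Proof. by move=> s; apply: val_inj; exact: mulVf (cvalP s). Qed.
HB.instance Definition _ :=
  GRing.isZmodule.Build circ circ_addA circ_addC circ_add0 circ_addN.

Lemma cval_mulrn (t : circ) n : cval (t *+ n) = cval t ^+ n.
Proof. by elim: n => // n IH; rewrite mulrS exprS -IH. Qed.

Lemma circ_divisible n (t : circ) : (0 < n)%N -> exists u : circ, u *+ n = t.
Proof.
move=> n0; have nz : n.-root (cval t) != 0.
  by rewrite rootC_eq0 // (cvalP t).
by exists (Circ nz); apply: val_inj; rewrite [LHS]cval_mulrn /= rootCK.
Qed.

Lemma circ_torsion n : n != 1 -> exists2 t : circ, t != 0 & t *+ n = 0.
Proof.
case: n => [_|n n1].
  (* For [n = 0] the torsion condition is void, and the number 2 is simply an element other than the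
     neutral element 1. For larger [n] a primitive root of unity serves. *)
  have nz : (2 : algC) != 0 by rewrite pnatr_eq0.
  by exists (Circ nz) => //; rewrite -val_eqE /= (eqr_nat _ 2 1).
have [z zp] := C_prim_root_exists (ltn0Sn n).
have z0 : z != 0.
  apply/eqP => z0; move: (prim_expr_order zp).
  by rewrite z0 expr0n => /eqP; rewrite eq_sym oner_eq0.
exists (Circ z0); last by apply: val_inj; rewrite [LHS]cval_mulrn /= prim_expr_order.
rewrite -val_eqE /=; apply: contra n1 => /eqP z1.
by move: (prim_order_dvd zp 1); rewrite z1 expr1n eqxx dvdn1 => ->.
Qed.

(** Division with remainder by the least positive [n] with [g *+ n] in [H]. If there is none,
    [n = 0] works, since 0 divides only 0. *)
Lemma subgroup_period (G : zmodType) (H : G -> Prop) (g : G) :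
  H 0 -> (forall x y, H x -> H y -> H (x - y)) ->
  exists n, forall m, H (g *+ m) <-> (n %| m)%N.
Proof.
move=> H0 HB.
have Hmul x q : H x -> H (x *+ q).
  move=> Hx; elim: q => // q IH; rewrite mulrS -[_ *+ q]opprK.
  by apply: (HB) => //; rewrite -[- _]sub0r; apply: (HB).
have [ex|nex] := pselect (exists n, `[< (0 < n)%N /\ H (g *+ n) >]); last first.
  exists 0 => m; rewrite dvd0n; split=> [Hm|/eqP-> //].
  by apply/negPn/negP => m0; case: nex; exists m; apply/asboolP; rewrite lt0n.
case: (ex_minnP ex) => n /asboolP[n0 Hn] nmin; exists n => m; split=> [Hm|/dvdnP[q ->]].
  rewrite /dvdn; apply/negPn/negP => r0.
  have : (n <= m %% n)%N.
    apply/nmin/asboolP; split; first by rewrite lt0n.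
    rewrite (_ : g *+ (m %% n) = g *+ m - g *+ n *+ (m %/ n)).
      by apply: (HB) => //; exact: Hmul.
    by rewrite {2}(divn_eq m n) mulrnDr -mulrnA mulnC addrC addKr.
  by rewrite leqNgt ltn_mod n0.
by rewrite mulnC mulrnA; exact: Hmul.
Qed.

(** * Extension of partial characters and separation from subgroups *)

Section Extension.
Variable G : zmodType.
Implicit Types S : set (G * circ).

(** The graph of a homomorphism from a subgroup of [G] to [circ]: for a subgroup of the product, the
    last clause is single-valuedness. With graphs, the upper bound of a chain is its union. *)
Definition partial_char S :=
  [/\ S (0, 0), forall u v, S u -> S v -> S (u - v) & forall t, S (0, t) -> t = 0].

(** With [n] the period of [g] modulo the domain of [S], the value [t] at [g] is an [n]-th root of
    the value prescribed at [g *+ n], which exists by divisibility; for [n = 0] the value 0 is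
    taken. *)
Lemma partial_char_extend1 S g : partial_char S ->
  exists t, forall (k : int) s, S (g *~ k, s) -> s = t *~ k.
Proof.
case=> S0 SB S1.
pose H x := exists s, S (x, s).
have [| |n Hn] := @subgroup_period G H g; first by exists 0.
  by move=> x y [s xs] [t yt]; exists (s - t); have := SB _ _ xs yt.
have [t tP] : exists t, forall s, S (g *+ n, s) -> s = t *+ n.
  have [s0 Ss0] : H (g *+ n) by apply/Hn.
  have uniqS s : S (g *+ n, s) -> s = s0.
    move=> Ss; apply/eqP; rewrite -subr_eq0; apply/eqP/S1.
    by rewrite -(subrr (g *+ n)); exact: SB Ss Ss0.
  case: (posnP n) => [n0|n0].
    exists 0 => s; rewrite n0 !mulr0n; exact: S1.
  by have [t tE] := circ_divisible s0 n0; exists t => s /uniqS ->.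
have Snat (m : nat) s : S (g *+ m, s) -> s = t *+ m.
  move=> Sm; have /dvdnP[q mE] : (n %| m)%N by apply/Hn; exists s.
  have [s0 Ss0] : H (g *+ n) by apply/Hn.
  have Sq : S (g *+ m, s0 *+ q).
    rewrite mE mulnC mulrnA; elim: (q) => [//|p IH].
    have := SB _ _ Ss0 (SB _ _ S0 IH).
    by rewrite !sub0r !opprK /= !mulrS.
  have /S1/eqP : S (0, s - s0 *+ q) by rewrite -(subrr (g *+ m)); exact: SB Sm Sq.
  by rewrite subr_eq0 => /eqP ->; rewrite (tP _ Ss0) mE mulnC mulrnA.
exists t => -[m|m] s /= Sm; first by apply: Snat; move: Sm; rewrite -pmulrn.
rewrite NegzE mulrNz -pmulrn -[s]opprK; congr (- _); apply: Snat.
have : S (0 - g *~ Negz m, 0 - s) := SB _ _ S0 Sm.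
by rewrite !sub0r NegzE mulrNz opprK -pmulrn.
Qed.

Lemma char_extension S : partial_char S ->
  exists f : G -> circ, {morph f : x y / x + y} /\ forall x t, S (x, t) -> f x = t.
Proof.
move=> PS; have [|A [[A0 AB A1] SA maxA]] := zorn_above PS.
  move=> F [X0 FX0] FP Ftot; split.
  - by exists X0 => //; case: (FP _ FX0).
  - move=> u v [X FX Xu] [Y FY Yv]; case: (Ftot X Y FX FY) => XY.
      by exists Y => //; have [_ h _] := FP _ FY; apply: h => //; exact: XY.
    by exists X => //; have [_ h _] := FP _ FX; apply: h => //; exact: XY.
  - by move=> t [X FX]; have [_ _] := FP _ FX; exact.
have PA : partial_char A by [].
have AD u v : A u -> A v -> A (u + v).
  by move=> Au Av; rewrite -[v]opprK -[- v]sub0r; apply: (AB) => //; exact: AB.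
have total g : exists t, A (g, t).
  have [t tP] := partial_char_extend1 g PA; exists t.
  (* The subgroup generated by [A] and [(g, t)]. The choice of [t] makes it single-valued, so
     maximality puts [(g, t)] in [A]. *)
  pose B : set (G * circ) := fun u => exists v (k : int), A v /\ u = v + (g *~ k, t *~ k).
  apply: (maxA B); last first.
  - by exists 0, 1; split=> //; rewrite add0r !mulr1z.
  - split.
    + by exists 0, 0; split=> //; rewrite !mulr0z addr0.
    + move=> _ _ [v [k [Av ->]]] [w [l [Aw ->]]]; exists (v - w), (k - l).
      split; first exact: AB.
      by rewrite opprD addrACA !mulrzBr.
    + move=> s [[x r] [k [Av [xE ->]]]].
      have xk : x = g *~ (- k) by apply/eqP; rewrite mulrNz -addr_eq0 -xE.
      by move: Av; rewrite xk => /tP ->; rewrite mulrNz addNr.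
  - by move=> u Au; exists u, 0; split=> //; rewrite !mulr0z addr0.
have uniqA x s t : A (x, s) -> A (x, t) -> s = t.
  move=> As At; apply/eqP; rewrite -subr_eq0; apply/eqP/A1.
  by rewrite -(subrr x); exact: AB As At.
have [f fP] := choice total; exists f; split.
  by move=> x y; apply: uniqA (fP _) _; exact: (AD _ _ (fP x) (fP y)).
by move=> x t /SA; exact: uniqA.
Qed.

(** The period [n] of [g] modulo [H] is not 1, so some nonzero [t] is killed by [n]. Sending [H] to
    0 and [g] to [t] is then well defined on the subgroup they generate, and it extends to [G]. *)
Lemma char_separation (H : G -> Prop) (g : G) :
  H 0 -> (forall x y, H x -> H y -> H (x - y)) -> ~ H g ->
  exists f : G -> circ, [/\ {morph f : x y / x + y}, forall x, H x -> f x = 0 & f g <> 0].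
Proof.
move=> H0 HB Hg; have [n Hn] := subgroup_period g H0 HB.
have n1 : n != 1 by apply/eqP => n1; apply: Hg; have [_] := Hn 1; rewrite n1; exact.
have [t t0 tn] := circ_torsion n1.
have HN x : H (- x) <-> H x.
  suff h y : H y -> H (- y) by split=> [/h|/h]; rewrite ?opprK.
  by rewrite -sub0r; exact: HB.
have tH (k : int) : H (g *~ k) -> t *~ k = 0.
  case: k => m; rewrite ?NegzE ?mulrNz -!pmulrn ?HN => /Hn/dvdnP[q ->];
  by rewrite mulnC mulrnA tn mul0rn ?oppr0.
pose S : set (G * circ) := fun u => exists h (k : int), H h /\ u = (h + g *~ k, t *~ k).
have [|f [fD fS]] := @char_extension S.
  split.
  - by exists 0, 0; rewrite !mulr0z addr0.
  - move=> _ _ [h [k [Hh ->]]] [h' [k' [Hh' ->]]]; exists (h - h'), (k - k').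
    split; first exact: HB.
    by rewrite !mulrzBr addrACA -opprD.
  - move=> _ [h [k [Hh [/esym/eqP hE ->]]]]; apply: tH.
    by move: hE; rewrite addrC addr_eq0 => /eqP ->; apply/HN.
exists f; split=> // [x Hx|].
  by apply: fS; exists x, 0; rewrite !mulr0z addr0.
rewrite (fS g t); first exact/eqP.
by exists 0, 1; rewrite !mulr1z add0r.
Qed.

End Extension.

Record chr (G : zmodType) :=
  Chr { chr_fun :> G -> circ; chrD : {morph chr_fun : x y / x + y} }.

Lemma chrP (G : zmodType) (f g : chr G) : f =1 g -> f = g.
Proof.
case: f g => [f fD] [g gD] /= /funext fg; rewrite fg in fD *.
by congr Chr; exact: Prop_irrelevance.
Qed.

Section CharGroup.
Variable G : zmodType.
Implicit Types f g : chr G.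

Lemma chr0 f : f 0 = 0.
Proof. by apply: (addIr (f 0)); rewrite -chrD !add0r. Qed.

Lemma chr_sum f I (r : seq I) (F : I -> G) :
  f (\sum_(i <- r) F i) = \sum_(i <- r) f (F i).
Proof. exact: (big_morph f (chrD f) (chr0 f)). Qed.

Fact chr0_subproof : {morph (fun=> 0) : x y / x + y : G >-> x + y : circ}.
Proof. by move=> x y; rewrite addr0. Qed.
Fact chrD_subproof f g : {morph (fun x => f x + g x) : x y / x + y}.
Proof. by move=> x y; rewrite !chrD addrACA. Qed.
Fact chrN_subproof f : {morph (fun x => - f x) : x y / x + y}.
Proof. by move=> x y; rewrite chrD opprD. Qed.

Definition chr_zero := Chr chr0_subproof.
Definition chr_plus f g := Chr (chrD_subproof f g).
Definition chr_opp f := Chr (chrN_subproof f).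

Fact chr_addA : associative chr_plus.
Proof. by move=> f g h; apply: chrP => x /=; rewrite addrA. Qed.
Fact chr_addC : commutative chr_plus.
Proof. by move=> f g; apply: chrP => x /=; rewrite addrC. Qed.
Fact chr_add0 : left_id chr_zero chr_plus.
Proof. by move=> f; apply: chrP => x /=; rewrite add0r. Qed.
Fact chr_addN : left_inverse chr_zero chr_opp chr_plus.
Proof. by move=> f; apply: chrP => x /=; rewrite addNr. Qed.

HB.instance Definition _ := gen_eqMixin (chr G).
HB.instance Definition _ := gen_choiceMixin (chr G).
HB.instance Definition _ :=
  GRing.isZmodule.Build (chr G) chr_addA chr_addC chr_add0 chr_addN.

Lemma chr_sumE I (r : seq I) (F : I -> chr G) x :
  (\sum_(i <- r) F i) x = \sum_(i <- r) F i x.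
Proof. by elim/big_rec2: _ => // i y f _ <-. Qed.

End CharGroup.

(** * The character bidual of a module and its pure embedding *)

Section Bidual.
Variables (R : pzRingType) (M : lmodType R).

Fact chr_act_subproof (r : R) (f : chr M) : {morph (fun x => f (r *: x)) : x y / x + y}.
Proof. by move=> x y; rewrite scalerDr chrD. Qed.
(** This is a right action of [R] on characters; its transpose is the left action on the bidual. *)
Definition chr_act r f := Chr (chr_act_subproof r f).

Lemma chr_actD r : {morph chr_act r : f g / f + g}.
Proof. by move=> f g; apply: chrP. Qed.

Definition bidual := chr (chr M).
HB.instance Definition _ := GRing.Zmodule.on bidual.

Fact bidual_scale_subproof (r : R) (a : bidual) :
  {morph (fun f => a (chr_act r f)) : x y / x + y}.
Proof. by move=> f g; rewrite chr_actD chrD. Qed.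
Definition bidual_scale r a : bidual := Chr (bidual_scale_subproof r a).

Fact bidual_scaleA r s a : bidual_scale r (bidual_scale s a) = bidual_scale (r * s) a.
Proof. by apply: chrP => f; congr (a _); apply: chrP => x /=; rewrite scalerA. Qed.
Fact bidual_scale1 : left_id 1 bidual_scale.
Proof. by move=> a; apply: chrP => f; congr (a _); apply: chrP => x /=; rewrite scale1r. Qed.
Fact bidual_scaleDr : right_distributive bidual_scale +%R.
Proof. by move=> r a b; apply: chrP. Qed.
Fact bidual_scaleDl a : {morph bidual_scale^~ a : r s / r + s}.
Proof.
move=> r s; apply: chrP => f; rewrite [RHS]/= -chrD; congr (a _).
by apply: chrP => x /=; rewrite scalerDl chrD.
Qed.
HB.instance Definition _ := GRing.Zmodule_isLmodule.Build R bidual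
  bidual_scaleA bidual_scale1 bidual_scaleDr bidual_scaleDl.

Fact bidual_emb_subproof (x : M) : {morph (fun f : chr M => f x) : f g / f + g}.
Proof. by []. Qed.
Definition bidual_emb x : bidual := Chr (bidual_emb_subproof x).

Lemma bidual_emb_lin : lin bidual_emb.
Proof. by move=> r x y; apply: chrP => f /=; rewrite chrD. Qed.

Lemma bidual_emb_inj : injective bidual_emb.
Proof.
move=> x y xy; apply/eqP; rewrite -subr_eq0; apply/eqP; apply: contrapT => nxy.
have [||f [fD _]] := @char_separation M (eq^~ 0) (x - y) _ _ nxy => //.
  by move=> _ _ -> ->; rewrite subr0.
apply; rewrite fD; have := congr1 (fun a : bidual => a (Chr fD)) xy => /= ->.
by rewrite -fD subrr; exact: (chr0 (Chr fD)).
Qed.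

(* If the constant term of the system is not in the image of A, some character
   of M^m kills that image but not the constant term; its components, paired
   with a solution in the bidual, give a contradiction. *)
Lemma bidual_emb_pure : pure_emb bidual_emb.
Proof.
split; [exact: bidual_emb_lin|split; first exact: bidual_emb_inj].
move=> m n k A B a [y yP]; apply: contrapT => nsol.
pose v := [ffun i => \sum_(l < k) B i l *: a l].
pose Im (z : {ffun 'I_m -> M}) :=
  exists x : 'I_n -> M, forall i, z i = \sum_(j < n) A i j *: x j.
have [|||f [fD f0 fv]] := @char_separation _ Im v.
- by exists (fun=> 0) => i; rewrite ffunE big1 // => j _; rewrite scaler0.
- move=> u w [x xP] [x' x'P]; exists (fun j => x j - x' j) => i.
  rewrite !ffunE xP x'P -sumrB; apply: eq_bigr => j _.
  by rewrite scalerBr.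
- case=> x xP; apply: nsol; exists (fun j => - x j) => i.
  move: (xP i); rewrite ffunE => ->; rewrite -big_split big1 //= => j _.
  by rewrite scalerN addNr.
apply: fv; pose F := Chr fD.
pose emb i (x : M) : {ffun 'I_m -> M} := [ffun i' => if i' == i then x else 0].
have embD i : {morph (fun x => F (emb i x)) : x y / x + y}.
  move=> x z; rewrite -chrD; congr (F _); apply/ffunP => i'.
  by rewrite !ffunE; case: eqP => // _; rewrite addr0.
pose c i := Chr (embD i).
have embS (z : {ffun 'I_m -> M}) : f z = \sum_i c i (z i).
  rewrite -(chr_sum F); congr (F _); apply/ffunP => i'.
  rewrite sum_ffunE (bigD1 i') //= !ffunE eqxx big1 ?addr0 // => i ii'.
  by rewrite ffunE eq_sym (negPf ii').
(* Tested on vectors with a single nonzero unknown, the vanishing of [f] on the image says that each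
   column of [A] pairs to 0 with the components [c]. Hence the unknowns [y] drop out of the sum
   below. *)
have cA j : \sum_i chr_act (A i j) (c i) = 0.
  apply: chrP => x; rewrite chr_sumE -[RHS](f0 [ffun i => A i j *: x]).
    by rewrite embS; apply: eq_bigr => i _; rewrite ffunE.
  exists (fun j' => if j' == j then x else 0) => i.
  rewrite ffunE (bigD1 j) //= eqxx big1 ?addr0 // => j' /negPf ->.
  by rewrite scaler0.
have : \sum_i (\sum_(j < n) A i j *: y j + \sum_(l < k) B i l *: bidual_emb (a l)) (c i) = 0.
  by rewrite big1 // => i _; rewrite yP.
have -> : \sum_i (\sum_(j < n) A i j *: y j +
     \sum_(l < k) B i l *: bidual_emb (a l)) (c i) =
  \sum_i (\sum_(j < n) A i j *: y j) (c i) +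
  \sum_i (\sum_(l < k) B i l *: bidual_emb (a l)) (c i) by rewrite -big_split.
rewrite [X in X + _](_ : _ = 0) ?add0r.
  move=> <-; rewrite embS; apply: eq_bigr => i _.
  by rewrite ffunE chr_sum chr_sumE.
under eq_bigr do rewrite chr_sumE.
rewrite exchange_big big1 //= => j _.
by rewrite -chr_sum cA chr0.
Qed.

End Bidual.

(** * Linear systems and algebraic compactness *)

Section LinearSystems.
Variable R : pzRingType.
Implicit Types M N P E : lmodType R.

Definition lc E X (x : X -> E) (s : seq (R * X)) : E := \sum_(p <- s) p.1 *: x p.2.

(** [S s e] puts the equation [lc x s = e] into the system. Both the set of equations and the set
    [X] of unknowns may be infinite. *)
Definition alg_compact E : Prop :=
  forall (X : Type) (S : seq (R * X) -> E -> Prop),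
    (forall l : seq (seq (R * X) * E), (forall p, List.In p l -> S p.1 p.2) ->
       exists x : X -> E, forall p, List.In p l -> lc x p.1 = p.2) ->
    exists x : X -> E, forall s e, S s e -> lc x s = e.

Definition assign E X Y (x : X -> E) (y : Y -> E) (v : X + Y) : E :=
  match v with inl i => x i | inr j => y j end.

(* A pp-formula is a list of homogeneous equations; the variables in X are
   existentially quantified, those in Y are free. *)
Definition sat E X Y (phi : seq (seq (R * (X + Y)))) (y : Y -> E) : Prop :=
  exists x : X -> E, forall s, List.In s phi -> lc (assign x y) s = 0.

Lemma In_mem (T : eqType) (x : T) (s : seq T) : List.In x s <-> x \in s.
Proof.
elim: s => //= y s IH; rewrite in_cons; split.
  by case=> [->|/IH ->]; rewrite ?eqxx ?orbT.
by case/orP=> [/eqP ->|/IH]; [left|right].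
Qed.

Lemma In_map A B (f : A -> B) (s : seq A) y :
  List.In y (map f s) <-> exists2 x, List.In x s & y = f x.
Proof.
elim: s => [|a s IH] /=; first by split=> // -[].
split=> [[<-|ys]|[x [<-|xs] yE]]; first by exists a => //; left.
- by have /IH[x xs ->] := ys; exists x => //; right.
- by left.
- by right; apply/IH; exists x.
Qed.

Lemma lc_nil E X (x : X -> E) : lc x [::] = 0.
Proof. exact: big_nil. Qed.

Lemma lc_cons E X (x : X -> E) p s : lc x (p :: s) = p.1 *: x p.2 + lc x s.
Proof. exact: big_cons. Qed.

Lemma lc_map E X X' (g : X -> X') (x : X' -> E) s :
  lc x [seq (p.1, g p.2) | p <- s] = lc (x \o g) s.
Proof. exact: big_map. Qed.

Lemma lc_ext E X (x x' : X -> E) s :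
  (forall p, List.In p s -> x p.2 = x' p.2) -> lc x s = lc x' s.
Proof.
elim: s => [|p s IH] xx'; first by rewrite !lc_nil.
rewrite !lc_cons (xx' p); last by left.
by rewrite IH // => q qs; apply: xx'; right.
Qed.

Lemma lin0 M N (f : M -> N) : lin f -> f 0 = 0.
Proof.
by move=> fl; apply: (addIr (f 0)); have := fl 1 0 0; rewrite !scale1r !add0r => <-.
Qed.

Lemma lin_add M N (f : M -> N) : lin f -> {morph f : x y / x + y}.
Proof. by move=> fl x y; have := fl 1 x y; rewrite !scale1r. Qed.

Lemma lin_scale M N (f : M -> N) : lin f -> forall r x, f (r *: x) = r *: f x.
Proof. by move=> fl r x; have := fl r x 0; rewrite !addr0 lin0 // addr0. Qed.

Lemma lin_sub M N (f : M -> N) : lin f -> {morph f : x y / x - y}.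
Proof.
by move=> fl x y; rewrite -[- y]scaleN1r lin_add // lin_scale // scaleN1r.
Qed.

Lemma lin_sum M N (f : M -> N) I (r : seq I) (F : I -> M) :
  lin f -> f (\sum_(i <- r) F i) = \sum_(i <- r) f (F i).
Proof. by move=> fl; apply: (big_morph f (lin_add fl) (lin0 fl)). Qed.

Lemma lin_comp M N P (f : M -> N) (g : N -> P) : lin f -> lin g -> lin (g \o f).
Proof. by move=> fl gl r x y /=; rewrite fl gl. Qed.

Lemma lin_id M : lin (@id M).
Proof. by []. Qed.

Lemma lc_lin M N X (f : M -> N) (x : X -> M) s : lin f -> f (lc x s) = lc (f \o x) s.
Proof.
by move=> fl; rewrite lin_sum //; apply: eq_bigr => p _; rewrite lin_scale.
Qed.

Lemma lc_sub E X (x x' : X -> E) s : lc (fun v => x v - x' v) s = lc x s - lc x' s.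
Proof. by rewrite -sumrB; apply: eq_bigr => p _; rewrite scalerBr. Qed.

Lemma lin_sat M N X Y (f : M -> N) (phi : seq (seq (R * (X + Y)))) (y : Y -> M) :
  lin f -> sat phi y -> sat phi (f \o y).
Proof.
move=> fl [x xP]; exists (f \o x) => s /xP xs.
rewrite (_ : assign _ _ = f \o assign x y) -?lc_lin ?xs ?lin0 //.
by apply: funext => -[].
Qed.

(** Pp-formulas define subgroups; the counting of pp-types rests on this. *)
Lemma sat_sub E X Y (phi : seq (seq (R * (X + Y)))) (y y' : Y -> E) :
  sat phi y -> sat phi y' -> sat phi (fun j => y j - y' j).
Proof.
move=> [x xP] [x' x'P]; exists (fun i => x i - x' i) => s sphi.
rewrite (_ : assign _ _ = fun v => assign x y v - assign x' y' v).
  by rewrite lc_sub xP // x'P // subr0.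
by apply: funext => -[].
Qed.

Lemma sat_reindex X Y Y' (r : Y -> Y') (phi : seq (seq (R * (X + Y)))) :
  exists phi' : seq (seq (R * (X + Y'))),
    forall E (y : Y' -> E), sat phi' y <-> sat phi (y \o r).
Proof.
pose f (v : X + Y) : X + Y' := match v with inl i => inl i | inr j => inr (r j) end.
exists [seq [seq (p.1, f p.2) | p <- s] | s <- phi] => E y.
have assE x : assign x y \o f = assign x (y \o r) by apply: funext => -[].
split=> -[x xP]; exists x => s; first move=> sphi.
  by rewrite -assE -lc_map xP //; apply/In_map; exists s.
by move=> /In_map[t tphi ->]; rewrite lc_map assE xP.
Qed.

(** Only finitely many variables occur in [phi], so each can be replaced by its position in the list
    of those that occur. This reduces formulas over arbitrary index types to formulas over [nat],
    while [D] keeps track of the parameters involved. *)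
Lemma sat_rename (X : eqType) (x0 : X) (Y : eqType) (y0 : Y) (D : Y -> Prop)
    (phi : seq (seq (R * (X + Y)))) :
  (forall s p j, List.In s phi -> List.In p s -> p.2 = inr j -> D j) ->
  exists (psi : seq (seq (R * (nat + nat)))) (w : seq Y),
    (forall j, j \in w -> D j) /\
    forall E (y : Y -> E), sat phi y <-> sat psi (fun n => y (nth y0 w n)).
Proof.
move=> Dphi.
pose u : seq (X + Y) := [seq p.2 | p <- flatten phi].
pose v : seq X := pmap (fun z => if z is inl i then Some i else None) u.
pose w : seq Y := pmap (fun z => if z is inr j then Some j else None) u.
pose g (z : X + Y) : nat + nat :=
  match z with inl i => inl (index i v) | inr j => inr (index j w) end.
have uP s p : List.In s phi -> List.In p s -> p.2 \in u.
  move=> sphi ps; apply: (map_f (fun p : R * (X + Y) => p.2)); apply/flattenP.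
  by exists s; apply/In_mem.
have nthv s p i : List.In s phi -> List.In p s -> p.2 = inl i -> nth x0 v (index i v) = i.
  move=> sphi ps pi; apply: nth_index; rewrite mem_pmap; apply/mapP.
  by exists (inl i) => //; rewrite -pi; exact: uP ps.
have nthw s p j : List.In s phi -> List.In p s -> p.2 = inr j -> nth y0 w (index j w) = j.
  move=> sphi ps pj; apply: nth_index; rewrite mem_pmap; apply/mapP.
  by exists (inr j) => //; rewrite -pj; exact: uP ps.
exists [seq [seq (p.1, g p.2) | p <- s] | s <- phi], w; split.
  move=> j0; rewrite mem_pmap => /mapP[[//|j]] /mapP[p pphi pj] [->].
  have [s /In_mem sphi /In_mem ps] := flattenP pphi.
  exact: Dphi sphi ps (esym pj).
move=> E y; split=> -[x xP].
  exists (fun n => x (nth x0 v n)) => _ /In_map[s sphi ->]; rewrite lc_map -[RHS](xP s sphi).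
  apply: lc_ext => p ps /=; case pE : p.2 => [i|j] /=.
    by rewrite (nthv s p).
  by rewrite (nthw s p).
exists (fun i => x (index i v)) => s sphi.
rewrite -[RHS](xP [seq (p.1, g p.2) | p <- s]); last by apply/In_map; exists s.
rewrite lc_map; apply: lc_ext => p ps /=; case pE : p.2 => [i|j] //=.
by rewrite (nthw s p).
Qed.

(** The values of [f] are unknowns indexed by [E], subject to equations for linearity and for the
    prescribed values. Finitely many of these form a pp-formula on the family [y], true in [E]
    because the identity solves it, hence true of [y'] by hypothesis; algebraic compactness does the
    rest. *)
Lemma extend_hom E E' (Y : eqType) (y0 : Y) (D : Y -> Prop) (y : Y -> E) (y' : Y -> E') :
  alg_compact E' ->
  (forall (psi : seq (seq (R * (nat + nat)))) (w : seq Y), (forall j, j \in w -> D j) ->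
     sat psi (y \o nth y0 w) -> sat psi (y' \o nth y0 w)) ->
  exists f : E -> E', lin f /\ forall j, D j -> f (y j) = y' j.
Proof.
move=> cE' yy'.
pose S (s : seq (R * E)) (e : E') :=
  (exists r a b, s = [:: (r, a); (1, b); (-1, r *: a + b)] /\ e = 0) \/
  (exists j, D j /\ s = [:: (1, y j)] /\ e = y' j).
have [|f fS] := cE' E S.
  move=> l lS.
  (* [phi] is the finite system [l] with each constant [y' j] turned into the free variable [j]. *)
  suff [phi [Dphi phi1 phi2]] : exists phi : seq (seq (R * (E + Y))),
    [/\ forall s p j, List.In s phi -> List.In p s -> p.2 = inr j -> D j,
        forall s, List.In s phi -> lc (assign id y) s = 0 &
        forall x : E -> E', (forall s, List.In s phi -> lc (assign x y') s = 0) ->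
          forall p, List.In p l -> lc x p.1 = p.2].
    have [psi [w [Dw psiP]]] := sat_rename 0 y0 Dphi.
    have /psiP : sat phi y by exists id.
    move=> /(yy' psi w Dw) /psiP[x /phi2]; by exists x.
  elim: l lS => [|[s e] l IH] lS; first by exists [::]; split.
  have [|phi [Dphi phi1 phi2]] := IH; first by move=> p pl; apply: lS; right.
  have := lS (s, e) (or_introl erefl) => -[[r [a [b [/= sE eE]]]]|[j [Dj [/= sE eE]]]].
    exists ([:: (r, inl a); (1, inl b); (-1, inl (r *: a + b))] :: phi); split.
    - by move=> t p j [<-|/Dphi h]; [case=> [<-|[<-|[<-|[]]]]|exact: h].
    - move=> t [<-|/phi1 //]; rewrite !lc_cons lc_nil /=.
      by rewrite !scale1r scaleN1r addr0 addrA subrr.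
    - move=> x xphi p [<-|]; last by apply: phi2 => t tphi; apply: xphi; right.
      by rewrite /= sE eE -(xphi _ (or_introl erefl)) !lc_cons !lc_nil.
  exists ([:: (1, inl (y j)); (-1, inr j)] :: phi); split.
  - move=> t p i [<-|/Dphi h]; [case=> [<- //|[<- [<-] //|[]]]|exact: h].
  - by move=> t [<-|/phi1 //]; rewrite !lc_cons lc_nil /= scale1r scaleN1r addr0 subrr.
  - move=> x xphi p [<-|]; last by apply: phi2 => t tphi; apply: xphi; right.
    apply/eqP; rewrite /= sE eE -subr_eq0 -(xphi _ (or_introl erefl)) !lc_cons !lc_nil /=.
    by rewrite scaleN1r !addr0.
exists f; split=> [r a b|j Dj].
  have := fS [:: (r, a); (1, b); (-1, r *: a + b)] 0 (or_introl _).
  rewrite !lc_cons lc_nil /= scale1r scaleN1r addr0 addrA => h.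
  by apply/esym/eqP; rewrite -subr_eq0 h //; exists r, a, b.
rewrite -(fS [:: (1, y j)] (y' j)); last by right; exists j.
by rewrite lc_cons lc_nil addr0 scale1r.
Qed.

Lemma vars_bound (phi : seq (seq (R * (nat + nat)))) :
  exists n, forall s p, List.In s phi -> List.In p s ->
    (match p.2 with inl i | inr i => i end < n)%N.
Proof.
elim: phi => [|s phi [n nP]]; first by exists 0.
have [m mP] : exists m, forall p, List.In p s -> (match p.2 with inl i | inr i => i end < m)%N.
  elim: s => [|p s [m mP]]; first by exists 0.
  exists (maxn (match p.2 with inl i | inr i => i end).+1 m) => q [<-|/mP qm].
    exact: leq_maxl.
  exact: leq_trans qm (leq_maxr _ _).
exists (maxn m n) => t p [<-|tphi] pt; rewrite leq_max.
  by rewrite mP.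
by rewrite (nP t) // orbT.
Qed.

(** Collecting the coefficients of repeated variables turns a list of terms into the matrix form
    used by [pp_reflecting]. *)
Lemma lc_coef E n (z : nat + nat -> E) (s : seq (R * (nat + nat))) :
  (forall p, List.In p s -> (match p.2 with inl i | inr i => i end < n)%N) ->
  lc z s = \sum_(j < n) (\sum_(p <- s | p.2 == inl (j : nat)) p.1) *: z (inl (j : nat)) +
           \sum_(j < n) (\sum_(p <- s | p.2 == inr (j : nat)) p.1) *: z (inr (j : nat)).
Proof.
elim: s => [|p s IH] sn.
  rewrite lc_nil !big1 ?addr0 // => j _; by rewrite big_nil scale0r.
have {}IH := IH (fun q qs => sn q (or_intror qs)).
have pn := sn p (or_introl erefl).
have E1 v : (\sum_(q <- p :: s | q.2 == v) q.1) *: z v =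
    (if p.2 == v then p.1 *: z v else 0) + (\sum_(q <- s | q.2 == v) q.1) *: z v.
  by rewrite big_cons; case: ifP => _; rewrite ?add0r // scalerDl.
under eq_bigr do rewrite E1.
under [X in _ = _ + X]eq_bigr do rewrite E1.
rewrite !big_split addrACA -IH lc_cons; congr (_ + _).
case: p pn {sn E1} => r [i|i] /= pn.
  rewrite [X in X + _](bigD1 (Ordinal pn)) //= eqxx !big1 ?addr0 // => j ji.
  by case: eqP => // -[ij]; case/eqP: ji; apply: val_inj.
rewrite [X in _ + X](bigD1 (Ordinal pn)) //= eqxx !big1 ?addr0 ?add0r // => j ji.
by case: eqP => // -[ij]; case/eqP: ji; apply: val_inj.
Qed.

Lemma pure_sat M N (e : M -> N) (phi : seq (seq (R * (nat + nat)))) (w : nat -> M) :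
  pp_reflecting e -> sat phi (e \o w) -> sat phi w.
Proof.
move=> pe [x xP]; have [n nP] := vars_bound phi.
pose A (i : 'I_(size phi)) (v : nat + nat) := \sum_(p <- nth [::] phi i | p.2 == v) p.1.
have In_nth (i : 'I_(size phi)) : List.In (nth [::] phi i) phi.
  case: i => i /=; elim: (phi) i => [|s psi IH] [|i] //= ip; first by left.
  by right; apply: IH.
have [|y yP] := pe _ _ _ (fun i (j : 'I_n) => A i (inl (j : nat)))
    (fun i (j : 'I_n) => A i (inr (j : nat))) (fun j => w j).
  exists (fun j => x j) => i; rewrite -[RHS](xP _ (In_nth i)) (lc_coef (n := n)) //.
  by move=> p; apply: nP; exact: In_nth.
(* Variables of index at least [n] do not occur in [phi], so the default 0 is harmless. *)
exists (fun i => if insub i is Some j then y j else 0) => s sphi.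
have [i -> ] : exists i : 'I_(size phi), s = nth [::] phi i.
  have /In_mem sphi' := sphi; rewrite -(nth_index [::] sphi').
  by move: sphi'; rewrite -index_mem => h; exists (Ordinal h).
rewrite (lc_coef (n := n)); last by move=> p; apply: nP; exact: In_nth.
rewrite -[RHS](yP i); congr (_ + _); apply: eq_bigr => j _ /=.
by rewrite valK.
Qed.

(** A pp-formula true of a tuple of [e] in [N] descends to [M] by purity and is pushed to [P] by
    [f], so [extend_hom] applies. *)
Lemma extend_pure M N P (e : M -> N) (f : M -> P) :
  alg_compact P -> pure_emb e -> lin f -> exists g : N -> P, lin g /\ forall x, g (e x) = f x.
Proof.
move=> cP [_ [_ pe]] fl.
have [|g [gl gP]] := @extend_hom N P M 0 (fun=> True) e f cP.
  by move=> psi w _ /(pure_sat pe) /(lin_sat fl).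
by exists g; split=> // x; exact: gP.
Qed.

Lemma retract_direct_summand P N (e : P -> N) (g : N -> P) :
  lin e -> lin g -> cancel e g -> direct_summand e.
Proof.
move=> el gl ge; exists (fun n => g n = 0); split; first exact: lin0.
split=> [r x y gx gy|]; first by rewrite gl gx gy scaler0 addr0.
split=> [n|p]; last by rewrite ge => ->; apply: lin0.
exists (g n), (n - e (g n)); split; last by rewrite addrC subrK.
by rewrite -scaleN1r addrC gl ge scaleN1r addNr.
Qed.

Lemma alg_compact_pure_injective P : alg_compact P -> pure_injective P.
Proof.
move=> cP N e pe; have [g [gl ge]] := extend_pure cP pe (@lin_id P).
by apply: (retract_direct_summand _ gl ge); case: pe.
Qed.

(** A solution in [N] is split into its components in [P] and in the complement [C]. The error of
    the [P]-component lies in both summands, hence is 0. *)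
Lemma summand_alg_compact P N (e : P -> N) :
  lin e -> injective e -> direct_summand e -> alg_compact N -> alg_compact P.
Proof.
move=> el ei [C [C0 [Clin [Csum Cint]]]] cN X S Sfin.
have [|x xS] := cN X (fun s n => exists2 p, S s p & n = e p).
  move=> l lS.
  have [l' l'S l'E] : exists2 l' : seq (seq (R * X) * P),
      (forall p, List.In p l' -> S p.1 p.2) & l = [seq (q.1, e q.2) | q <- l'].
    elim: l lS => [|[s n] l IH] lS; first by exists [::].
    have [|l' l'S ->] := IH; first by move=> p pl; apply: lS; right.
    have [q Sq /= ->] := lS _ (or_introl erefl).
    by exists ((s, q) :: l') => // p [<-|/l'S].
  have [x xP] := Sfin l' l'S; exists (e \o x) => p; rewrite l'E => /In_map[q ql ->] /=.
  by rewrite -lc_lin // xP.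
have [p pP] := choice (fun i => Csum (x i)); have [c cP] := choice pP.
exists p => s q Sq; apply/eqP; rewrite -subr_eq0; apply/eqP/ei; rewrite (lin0 el).
apply: Cint.
have -> : e (lc p s - q) = - lc c s.
  have -> : c = fun i => x i - e (p i).
    by apply: funext => i; have [_ ->] := cP i; rewrite addrC addKr.
  rewrite lc_sub (xS s (e q)); last by exists q.
  by rewrite opprB -lc_lin // lin_sub.
suff Clc : C (lc c s).
  by rewrite -[- _]addr0 -scaleN1r; exact: Clin.
elim: (s) => [|t s' IH]; first by rewrite lc_nil.
by rewrite lc_cons; apply: Clin => //; case: (cP t.2).
Qed.

End LinearSystems.

(** * Algebraic compactness of the bidual *)

Section BidualCompact.
Variables (R : pzRingType) (M : lmodType R).

(** The hypothesis says that the formal sum of the [q.2], placed at coordinates [q.1], is 0 in the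
    direct sum of copies of [chr M]; the family [x] is a homomorphism from that direct sum to
    [circ]. *)
Lemma delta_sum (X : eqType) (t : seq (X * chr M)) (x : X -> bidual M) :
  (forall j, \sum_(q <- t) (if j == q.1 then q.2 else 0) = 0) ->
  \sum_(q <- t) x q.1 q.2 = 0.
Proof.
move=> t0; pose v := undup [seq q.1 | q <- t].
rewrite (_ : \sum_(q <- t) _ = \sum_(q <- t) \sum_(j <- v) x j (if j == q.1 then q.2 else 0)).
  by rewrite exchange_big big1 //= => j _; rewrite -chr_sum t0 chr0.
apply: eq_big_seq => q qt; rewrite (bigD1_seq q.1) ?undup_uniq //=; last first.
  by rewrite mem_undup map_f.
by rewrite eqxx big1 ?addr0 // => j /negPf ->; rewrite chr0.
Qed.

(** A family of unknowns in the bidual amounts to a homomorphism to [circ] from the direct sum of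
    copies of [chr M], so a system of equations prescribes values of a character. Finite solvability
    makes the prescription consistent, and [char_extension] yields a solution. *)
Lemma bidual_alg_compact : alg_compact (bidual M).
Proof.
move=> X0 S Sfin; pose X : eqType := {classic X0}.
pose delta (j : X) (f : chr M) : X -> chr M := fun i => if i == j then f else 0.
have deltaD j : {morph delta j : f g / f + g}.
  move=> f g; apply: funext => i; rewrite /delta /= /GRing.add /=.
  by case: eqP => // _; rewrite addr0.
(* The equation [lc x s = e] demands exactly the value [e f] at [key s f], for every [f]. *)
pose key (s : seq (R * X)) (f : chr M) : X -> chr M :=
  \sum_(q <- s) delta q.2 (chr_act q.1 f).
have keyD s : {morph key s : f g / f + g}.
  by move=> f g; rewrite /key -big_split; apply: eq_bigr => q _; rewrite chr_actD deltaD.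
have key0 s : key s 0 = 0 by apply: (addIr (key s 0)); rewrite -keyD !add0r.
have keyN s f : key s (- f) = - key s f.
  by apply: (addIr (key s f)); rewrite -keyD !addNr.
pose Gam : set ((X -> chr M) * circ) := fun u =>
  exists l : seq (seq (R * X) * bidual M * chr M),
    (forall p, List.In p l -> S p.1.1 p.1.2) /\
    u = (\sum_(p <- l) key p.1.1 p.2, \sum_(p <- l) p.1.2 p.2).
have [|F [FD FG]] := @char_extension _ Gam.
  split.
  - by exists [::]; split=> //; rewrite !big_nil.
  - move=> _ _ [l [lS ->]] [l' [l'S ->]].
    exists (l ++ [seq (p.1, - p.2) | p <- l']); split.
      move=> p /(@List.in_app_iff _ l); case=> [/lS //|/In_map[q /l'S Sq ->]].
      exact: Sq.
    have keyE : \sum_(p <- l') key p.1.1 (- p.2) = - \sum_(p <- l') key p.1.1 p.2.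
      by rewrite -sumrN; apply: eq_bigr => p _; rewrite keyN.
    have evE : \sum_(p <- l') p.1.2 (- p.2) = - \sum_(p <- l') p.1.2 p.2.
      rewrite -sumrN; apply: eq_bigr => p _; apply/eqP.
      by rewrite -addr_eq0 -chrD addNr chr0.
    by rewrite !big_cat !big_map /= keyE evE.
  - move=> t [l [lS [l0 ->]]].
    (* Single-valuedness: a solution of the finitely many equations in [l] computes the value [t]
       from a vanishing argument. *)
    have [|x xP] := Sfin [seq p.1 | p <- l]; first by move=> _ /In_map[p /lS pl ->].
    pose t' := [seq (q.2, chr_act q.1 p.2) | p <- l, q <- p.1.1].
    transitivity (\sum_(q <- t') (x : X -> bidual M) q.1 q.2).
      rewrite big_allpairs_dep; elim: l xP {lS l0 t'} => [|p l IH] xP.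
        by rewrite !big_nil.
      rewrite !big_cons IH; last by move=> q ql; apply: xP; right.
      congr (_ + _); rewrite -(xP p.1); last by left.
      by rewrite chr_sumE.
    apply: delta_sum => j; rewrite big_allpairs_dep.
    transitivity ((\sum_(p <- l) key p.1.1 p.2) j); last by rewrite -l0.
    by rewrite fct_sumE; apply: eq_bigr => p _; rewrite /key fct_sumE.
have fD j : {morph (fun f => F (delta j f)) : f g / f + g}.
  by move=> f g; rewrite deltaD FD.
exists (fun j => Chr (fD j)) => s e Se; apply: chrP => f.
transitivity (F (key s f)).
  by rewrite chr_sumE /key -[RHS]/(Chr FD _) chr_sum.
by apply: FG; exists [:: (s, e, f)]; split=> [p [<-|[]] //|]; rewrite !big_seq1.
Qed.

(** [M] is pure in its bidual, hence a direct summand of an algebraically compact module. *)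
Lemma pure_injective_alg_compact : pure_injective M -> alg_compact M.
Proof.
move=> piM; have pe := bidual_emb_pure M.
apply: summand_alg_compact (piM _ _ pe) bidual_alg_compact; first exact: bidual_emb_lin.
exact: bidual_emb_inj.
Qed.

End BidualCompact.

(** * Pure-injective envelopes *)

Section Purity.
Variable R : pzRingType.
Implicit Types M N P : lmodType R.

Lemma pp_reflecting_comp M N P (f : M -> N) (g : N -> P) :
  pp_reflecting f -> pp_reflecting g -> pp_reflecting (g \o f).
Proof. by move=> pf pg m n k A B a /(pg m n k A B (f \o a)) /pf. Qed.

Lemma pp_reflecting_compl M N P (f : M -> N) (g : N -> P) :
  lin g -> pp_reflecting (g \o f) -> pp_reflecting f.
Proof.
move=> gl pgf m n k A B a [y yP]; apply: pgf; exists (g \o y) => i.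
apply: etrans (etrans (congr1 g (yP i)) (lin0 gl)).
rewrite (lin_add gl) !(lin_sum _ _ gl).
by congr (_ + _); apply: eq_bigr => j _; rewrite lin_scale.
Qed.

Lemma pp_reflecting_retract M N (f : M -> N) (g : N -> M) :
  lin g -> cancel f g -> pp_reflecting f.
Proof.
move=> gl gf; apply: (pp_reflecting_compl gl).
move=> m n k A B a [y yP]; exists y => i; rewrite -[RHS](yP i).
by congr (_ + _); apply: eq_bigr => j _; rewrite /= gf.
Qed.

Lemma pure_emb_comp M N P (f : M -> N) (g : N -> P) :
  pure_emb f -> pure_emb g -> pure_emb (g \o f).
Proof.
move=> [fl [fi pf]] [gl [gi pg]]; split; first exact: lin_comp.
by split; [exact: inj_comp|exact: pp_reflecting_comp].
Qed.

Lemma pure_emb_retract M N (f : M -> N) (g : N -> M) :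
  lin f -> lin g -> cancel f g -> pure_emb f.
Proof.
move=> fl gl gf; split=> //; split; first exact: can_inj gf.
exact: pp_reflecting_retract gf.
Qed.

End Purity.

Section FixedModule.
Variables (R : pzRingType) (E : lmodType R) (h : E -> E) (hl : lin h).

Definition fixpred : {pred E} := fun x => h x == x.

Fact fixpred_closed : submod_closed fixpred.
Proof.
split=> [|r x y]; first by rewrite /fixpred unfold_in (lin0 hl).
by rewrite /fixpred !unfold_in => /eqP hx /eqP hy; rewrite hl hx hy.
Qed.

(* The argument hl, unused in the carrier, is what makes the module structure
   below canonical. *)
Record fixmod (H : lin h) := Fix { fval : E; fvalP : fval \in fixpred }.
HB.instance Definition _ := [isSub of fixmod hl for @fval hl].
HB.instance Definition _ := [Choice of fixmod hl by <:].
HB.instance Definition _ := GRing.SubChoice_isSubLmodule.Build R E fixpred (fixmod hl)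
  (GRing.submod_closed_semi fixpred_closed).

End FixedModule.

(** * Small sets over a subset of an algebraically compact module *)

Section Hull.
Variables (R : pzRingType) (E : lmodType R) (cE : alg_compact E).
Implicit Types A B C : set E.

(** Finite tuples are written [nth 0 w]; the entries beyond the list are 0, which every linear map
    fixes. *)
Definition small C B : Prop :=
  forall k : E -> E, lin k -> (forall c, C c -> k c = c) ->
  forall (psi : seq (seq (R * (nat + nat)))) (w : seq E), (forall x, x \in w -> B x) ->
    sat psi (k \o nth 0 w) -> sat psi (nth 0 w).

Lemma chain_seq (T : eqType) (F : set (set T)) (w : seq T) :
  (F !=set0)%classic -> total_on F subset ->
  (forall x, x \in w -> exists2 X, F X & X x) ->
  exists2 X, F X & forall x, x \in w -> X x.
Proof.
move=> [X0 FX0] Ftot; elim: w => [|x w IH] wF; first by exists X0.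
have [|X FX Xw] := IH; first by move=> y yw; apply: wF; rewrite in_cons yw orbT.
have [Y FY Yx] := wF x (mem_head _ _).
case: (Ftot X Y FX FY) => XY.
  by exists Y => // y; rewrite in_cons => /orP[/eqP -> //|/Xw/XY].
by exists X => // y; rewrite in_cons => /orP[/eqP ->|/Xw //]; exact: XY.
Qed.

Lemma small_refl C : small C C.
Proof.
move=> k kl kC psi w wC; rewrite (_ : k \o _ = nth 0 w) //; apply: funext => n /=.
have [nw|nw] := ltnP n (size w); first by apply/kC/wC/mem_nth.
by rewrite nth_default // (lin0 kl).
Qed.

(** Smallness only concerns finite tuples, and a finite tuple from the union of a chain lies in one
    member, so Zorn's lemma applies. *)
Lemma exists_maximal_small C : exists B,
  [/\ small C B, (C `<=` B)%classic &
    forall A, (B `<=` A)%classic -> small C A -> (A `<=` B)%classic].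
Proof.
apply: zorn_above; first exact: small_refl.
move=> F F0 FP Ftot k kl kC psi w wF.
have [X FX Xw] : exists2 X, F X & forall x, x \in w -> X x.
  by apply: chain_seq => // x /wF[X FX Xx]; exists X.
exact: (FP X FX).
Qed.

(** As [k] reflects pp-formulas on [B], some [l] undoes it there. Then [l \o k] fixes [B] pointwise,
    hence reflects pp-formulas on [A], and so does [k]. *)
Lemma small_trans C B A : (C `<=` B)%classic -> small C B -> small B A -> small C A.
Proof.
move=> CB sCB sBA k kl kC psi w wA kw.
have [|l [ll lP]] := @extend_hom _ E E E 0 B k id cE; first by move=> phi u uB; exact: sCB.
apply: (sBA (l \o k)) => //; first exact: lin_comp.
exact: lin_sat ll kw.
Qed.

(* Among the endomorphisms h fixing B pointwise, choose one for which the
   pp-type of (h e)_e is maximal; a maximal one exists by algebraic compactness. *)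
Lemma exists_small_range B : exists h : E -> E,
  [/\ lin h, forall b, B b -> h b = b & small B (range h)].
Proof.
pose F2 := seq (seq (R * (nat + E))).
pose P (T : set F2) := exists h : E -> E,
  [/\ lin h, forall b, B b -> h b = b & forall phi, T phi -> sat phi h].
have [||T [[h [hl hB hT]] _ maxT]] := @zorn_above _ P set0.
- by exists id; split.
- move=> F F0 FP Ftot.
  (* The unknowns are the values of the endomorphism sought, indexed by [E], and a separate copy of
     the existential witnesses for each formula. *)
  pose g (phi : F2) (v : nat + E) : E + F2 * nat :=
    match v with inl n => inr (phi, n) | inr a => inl a end.
  pose S (s : seq (R * (E + F2 * nat))) (e : E) :=
    [\/ exists r a b, s = [:: (r, inl a); (1, inl b); (-1, inl (r *: a + b))] /\ e = 0,
        exists b, B b /\ s = [:: (1, inl b)] /\ e = b |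
        exists (phi : F2) t, (exists2 X, F X & X phi) /\ List.In t phi /\
          s = [seq (p.1, g phi p.2) | p <- t] /\ e = 0].
  have [|x xS] := cE (S := S).
    move=> l lS.
    (* Only a finite list [Phi] of formulas enters [l]; it lies in one member of the chain, whose
       endomorphism solves [l]. *)
    have [Phi PhiF lPhi] : exists2 Phi : seq F2,
        (forall phi, phi \in Phi -> exists2 X, F X & X phi) &
        forall p, List.In p l ->
        [\/ exists r a b, p.1 = [:: (r, inl a); (1, inl b); (-1, inl (r *: a + b))] /\ p.2 = 0,
        exists b, B b /\ p.1 = [:: (1, inl b)] /\ p.2 = b |
        exists (phi : F2) t, phi \in Phi /\ List.In t phi /\
          p.1 = [seq (q.1, g phi q.2) | q <- t] /\ p.2 = 0].
      elim: l lS => [|p l IH] lS; first by exists [::].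
      have [|Phi PhiF lPhi] := IH; first by move=> q ql; apply: lS; right.
      case: (lS p (or_introl erefl)) => [H|H|[phi [t [Fphi H]]]].
      + by exists Phi => // q [<-|/lPhi //]; apply: Or31.
      + by exists Phi => // q [<-|/lPhi //]; apply: Or32.
      + exists (phi :: Phi) => [psi|q [<-|/lPhi]].
        * by rewrite in_cons => /orP[/eqP ->|/PhiF].
        * by apply: Or33; exists phi, t; rewrite mem_head.
        * case=> [Hq|Hq|[psi [u [psiPhi Hq]]]]; first exact: Or31.
            exact: Or32.
          by apply: Or33; exists psi, u; rewrite in_cons psiPhi orbT.
    have [X FX XPhi] := chain_seq F0 Ftot PhiF.
    have [h [hl hB hX]] := FP X FX.
    have [phi|W WP] := @choice _ _ (fun phi (x : nat -> E) => X phi ->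
        forall s, List.In s phi -> lc (assign x h) s = 0).
      have [/hX[x xP]|nX] := pselect (X phi); first by exists x.
      by exists (fun=> 0).
    exists (fun v => match v with inl a => h a | inr q => W q.1 q.2 end) => p.
    case/lPhi=> [[r [a [b [-> ->]]]]|[b [Bb [-> ->]]]|[phi [t [phiPhi [tphi [-> ->]]]]]].
    + by rewrite !lc_cons lc_nil /= hl scale1r scaleN1r addr0 addrA subrr.
    + by rewrite lc_cons lc_nil /= hB // scale1r addr0.
    + rewrite lc_map -[RHS](WP phi (XPhi _ phiPhi) t tphi).
      by apply: lc_ext => q _ /=; case: q.2.
  exists (x \o inl); split=> [r a b|b Bb|phi [X FX Xphi]].
  + have := xS [:: (r, inl a); (1, inl b); (-1, inl (r *: a + b))] 0.
    rewrite !lc_cons lc_nil /= scale1r scaleN1r addr0 addrA => h.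
    by apply/esym/eqP; rewrite -subr_eq0 h //; apply: Or31; exists r, a, b.
  + rewrite /= -[RHS](xS [:: (1, inl b)]); last by apply: Or32; exists b.
    by rewrite lc_cons lc_nil addr0 scale1r.
  + exists (fun n => x (inr (phi, n))) => s sphi.
    rewrite -[RHS](xS [seq (p.1, g phi p.2) | p <- s]).
      by rewrite lc_map; apply: lc_ext => q _ /=; case: q.2.
    by apply: Or33; exists phi, s; split=> //; exists X.
exists h; split=> // k kl kB psi w wh kw.
have [u wE] : exists u : seq E, w = map h u.
  elim: w wh {kw} => [|x w IH] wh; first by exists [::].
  have [|u ->] := IH; first by move=> y yw; apply: wh; rewrite in_cons yw orbT.
  by have [y _ <-] := wh x (mem_head _ _); exists (y :: u).
have wn n : nth 0 w n = h (nth 0 u n).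
  rewrite wE; have [nu|nu] := ltnP n (size u); first by rewrite (nth_map 0).
  by rewrite !nth_default ?size_map // (lin0 hl).
have [psi' psiE] := sat_reindex (nth 0 u) psi.
suff Tpsi : T psi'.
  have /psiE := hT _ Tpsi; by rewrite (_ : _ \o _ = nth 0 w) //; apply: funext => n.
(* [k \o h] realises all of [T] together with [psi'], the formula [psi] pulled back along [h], so
   maximality puts [psi'] in [T]. *)
apply: (maxT (T `|` [set psi'])%classic); [by move=> ? ?; left| |by right].
exists (k \o h); split; first exact: lin_comp.
  by move=> b Bb /=; rewrite hB // kB.
move=> phi [/hT|->]; first exact: lin_sat.
by apply/psiE; move: kw; congr sat; apply: funext => n /=; rewrite wn.
Qed.

(** For a maximal small [B], the range of [h] contains [B] and is small over [C] by transitivity.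
    Hence it equals [B], which [h] fixes. *)
Lemma exists_small_idempotent C : exists h : E -> E,
  [/\ lin h, forall c, C c -> h c = c, forall x, h (h x) = h x & small C (range h)].
Proof.
have [B [sB CB maxB]] := exists_maximal_small C.
have [h [hl hB sh]] := exists_small_range B.
have sCh := small_trans CB sB sh.
exists h; split=> // [c /CB /hB //|x].
apply: (hB); apply: (maxB _ _ sCh); last by exists x.
by move=> b Bb; exists b => //; rewrite hB.
Qed.

End Hull.

Lemma exists_PE (R : pzRingType) (M : lmodType R) :
  exists (P : lmodType R) (e : M -> P), is_PE e /\ alg_compact P.
Proof.
have cE := @bidual_alg_compact R M; have [il [ii ip]] := bidual_emb_pure M.
set E := bidual M in cE il ii ip; set i : M -> E := @bidual_emb R M in il ii ip.
have [h [hl hi hh sh]] := exists_small_idempotent cE (range i).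
pose P : lmodType R := fixmod hl.
pose inc (p : P) : E := fval p.
pose r (x : E) : P := Fix hl (introT eqP (hh x) : h x \in fixpred h).
pose e (x : M) : P := r (i x).
have incl : lin inc by [].
have rl : lin r by move=> a x y; apply: val_inj; exact: hl.
have incr x : inc (r x) = h x by [].
have rinc : cancel inc r by move=> p; apply: val_inj; exact: (eqP (fvalP p)).
have ince x : inc (e x) = i x by rewrite incr hi //; exists x.
have el : lin e by exact: lin_comp il rl.
have pe : pure_emb e.
  split=> //; split.
    by move=> x y /(congr1 inc); rewrite !ince; exact: ii.
  apply: (pp_reflecting_compl incl); rewrite (_ : inc \o e = i) //.
  exact: funext.
have cP : alg_compact P.
  have sP := retract_direct_summand incl rl rinc.
  by apply: summand_alg_compact sP cE => //; exact: can_inj rinc.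
(* Endomorphisms over M reflect pp-formulas, hence are left invertible. *)
have linv (g : P -> P) : lin g -> (forall x, g (e x) = e x) ->
    exists l : P -> P, [/\ lin l, forall p, l (g p) = p & forall x, l (e x) = e x].
  move=> gl ge.
  have [|l [ll lg]] := @extend_hom _ P P P 0 (fun=> True) g id cP.
    move=> psi w _ gw.
    have wE n : nth 0 (map inc w) n = inc (nth 0 w n).
      have [nw|nw] := ltnP n (size w); first by rewrite (nth_map 0).
      by rewrite !nth_default ?size_map.
    have : sat psi (nth 0 (map inc w)).
      (* The endomorphism [g] of [P] is transported to [E], where smallness of the range of [h] over
         the image of [M] applies. *)
      apply: (sh (inc \o g \o r)).
      - exact: lin_comp rl (lin_comp gl incl).
      - by move=> _ [x _ <-]; rewrite /= -[r (i x)]/(e x) ge ince.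
      - move=> _ /mapP[p _ ->]; exists (inc p) => //; exact: (eqP (fvalP p)).
      - rewrite (_ : _ \o nth 0 (map inc w) = inc \o (g \o nth 0 w)); first exact: lin_sat.
        by apply: funext => n /=; rewrite wE rinc.
    move/(lin_sat rl); congr sat; apply: funext => n /=.
    by rewrite wE rinc.
  exists l; split=> // [p|x]; first exact: lg.
  by rewrite -{1}(ge x) lg.
exists P, e; split=> //; split=> //; split; first exact: alg_compact_pure_injective.
move=> P' e' h' pe' piP' h'l h'i h'e p.
have cP' := pure_injective_alg_compact piP'.
have [k [kl ke]] := extend_pure cP' pe (proj1 pe').
have [|x|l [ll lg le]] := linv (h' \o k); first exact: lin_comp.
  by rewrite /= ke h'e.
(* [l] is a left inverse of [h' \o k] and is itself left invertible, so the two are mutually inverse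
   and [h'] is onto. *)
have [l' [_ l'l _]] := linv l ll le.
by exists (k (l p)); rewrite -[LHS]l'l -[in RHS](l'l p); congr l'; exact: lg.
Qed.

(** * Galois types and pp-types *)

Section Exponents.
Variable L : Type.

Definition exponent_le (A : Type) : Prop := exists F : (A -> L) -> L, injective F.

Lemma exponent_le_retract A B (s : A -> B) (g : B -> A) :
  cancel g s -> exponent_le A -> exponent_le B.
Proof.
move=> gs [F Fi]; exists (fun f => F (f \o s)) => f f' /Fi ff'.
by apply: funext => b; have := congr1 (fun h => h (g b)) ff'; rewrite /= gs.
Qed.

Lemma exponent_le_prod A B : exponent_le A -> exponent_le B -> exponent_le (A * B).
Proof.
move=> [F Fi] [G Gi]; exists (fun f => F (fun a => G (fun b => f (a, b)))) => f f' /Fi ff'.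
apply: funext => -[a b].
by have /Gi/(congr1 (fun h => h b)) := congr1 (fun h => h a) ff'.
Qed.

(* L^(seq A) is the product over n of the L^(A^n), each of which embeds in L. *)
Lemma exponent_le_seq A : exponent_le nat -> exponent_le A -> exponent_le (seq A).
Proof.
move=> [N Ni] [F Fi].
pose G := fix G n (f : seq A -> L) : L :=
  if n is n'.+1 then F (fun a => G n' (fun l => f (a :: l))) else f [::].
have Gi n : forall f f', G n f = G n f' -> forall l, size l = n -> f l = f' l.
  elim: n => [|n IH] f f'; first by move=> /= ff' [].
  move=> /Fi ff' [//|a l] [ln].
  exact: (IH (fun l => f (a :: l)) (fun l => f' (a :: l)) (congr1 (fun h => h a) ff')).
exists (fun f => N (fun n => G n f)) => f f' /Ni ff'; apply: funext => l.
exact: (Gi (size l)) (congr1 (fun h => h (size l)) ff') l erefl.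
Qed.

(** Pairs of a formula and a position index the coordinates of the codes of pp-types. *)
Lemma exponent_le_formulas (R : pzRingType) :
  exponent_le (R + nat) -> exponent_le (seq (seq (R * (nat + nat))) * nat).
Proof.
move=> eRN.
have eN : exponent_le nat.
  by apply: (@exponent_le_retract _ _ (fun z => if z is inr n then n else 0%N) inr) eRN.
have eR : exponent_le R.
  by apply: (@exponent_le_retract _ _ (fun z => if z is inl r then r else 0) inl) eRN.
apply: exponent_le_prod => //; do 2!apply: exponent_le_seq => //.
apply: exponent_le_prod => //.
apply: (@exponent_le_retract _ _ (fun n => odflt (inl 0%N) (unpickle n)) pickle) eN.
by move=> z; rewrite pickleK.
Qed.

End Exponents.

Section ProductModule.
Variables (R : pzRingType) (M N : lmodType R).

Definition summand (i : bool) : lmodType R := if i then M else N.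

Definition summand_inj (i : bool) : summand i -> (M * N)%type :=
  if i return summand i -> (M * N)%type then fun x => (x, 0) else fun y => (0, y).

Lemma prod_is_direct_sum : @is_direct_sum R bool summand (M * N)%type summand_inj.
Proof.
split=> [[] r x y /=|]; [by congr (_, _); rewrite /= ?scaler0 ?addr0..|split].
  move=> [a b]; exists [:: true; false], (fun i => if i return summand i then a else b).
  by rewrite !big_cons big_nil addr0; congr (_, _); rewrite ?addr0 ?add0r.
move=> s x nds.
have -> : \sum_(i <- s) summand_inj (x i) =
    (if true \in s then (x true : M) else 0, if false \in s then (x false : N) else 0).
  elim: s nds => [|i s IH] nds; first by rewrite big_nil.
  case/List.NoDup_cons_iff: nds => /In_mem; rewrite big_cons => is_ /IH ->.
  case: i is_ => /negP/negPf is_; rewrite !in_cons is_ /=; congr (_, _);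
  by rewrite ?addr0 ?add0r.
by case=> x1 x2 [] /In_mem si; move: x1 x2; rewrite si.
Qed.

End ProductModule.

Section GaloisTypes.
Variables (R : pzRingType) (K : lmodType R -> Prop) (M : lmodType R).

Definition point_tuple (t : gtriple R M) (o : option M) : gN t :=
  if o is Some m then gf t m else gb t.

Definition same_pp_type (t1 t2 : gtriple R M) : Prop :=
  forall (psi : seq (seq (R * (nat + nat)))) (u : nat -> option M),
    sat psi (point_tuple t1 \o u) <-> sat psi (point_tuple t2 \o u).

(** A pp-formula true in [P1] descends to [gN t1] by purity, passes to [gN t2] by equality of types
    and is pushed to [P2]; [extend_hom] then gives [f]. *)
Lemma same_pp_type_hom (t1 t2 : gtriple R M) (P1 P2 : lmodType R)
    (e1 : gN t1 -> P1) (e2 : gN t2 -> P2) :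
  same_pp_type t1 t2 -> pure_emb e1 -> pure_emb e2 -> alg_compact P2 ->
  exists f : P1 -> P2, [/\ lin f, forall m, f (e1 (gf t1 m)) = e2 (gf t2 m) &
    f (e1 (gb t1)) = e2 (gb t2)].
Proof.
move=> tt [_ [_ p1]] [l2 _] cP2.
have [|f [fl fP]] := @extend_hom R P1 P2 (option M) None (fun=> True)
    (e1 \o point_tuple t1) (e2 \o point_tuple t2) cP2.
  by move=> psi u _ /(pure_sat p1) /tt /(lin_sat l2).
by exists f; split=> // [m|]; [exact: (fP (Some m))|exact: (fP None)].
Qed.

(* Given f : P1 -> P2 and g : P2 -> P1 over M exchanging the two points, the map
   x |-> (x - g (f x), f x), split by (u, v) |-> u + g v, agrees over M and the
   points with y |-> (0, y). *)
Lemma same_pp_type_gtpE (hdsum : dsum_closed K) (hPE : PE_closed K)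
    (t1 t2 : gtriple R M) :
  K (gN t1) -> pure_emb (gf t1) -> K (gN t2) -> pure_emb (gf t2) ->
  same_pp_type t1 t2 -> gtpE K t1 t2.
Proof.
move=> K1 [_ [i1 _]] K2 [_ [i2 _]] tt.
have [P1 [e1 [PE1 c1]]] := exists_PE (gN t1).
have [P2 [e2 [PE2 c2]]] := exists_PE (gN t2).
have [p1 p2] := (proj1 PE1, proj1 PE2).
have [f [fl fM fb]] := same_pp_type_hom tt p1 p2 c2.
have [g [gl gM gb']] := same_pp_type_hom (fun psi u => iff_sym (tt psi u)) p2 p1 c1.
split; first by []; split; first by [].
pose j1 (x : P1) : (P1 * P2)%type := (x - g (f x), f x).
pose j2 (y : P2) : (P1 * P2)%type := (0, y).
exists (P1 * P2)%type, (j1 \o e1), (j2 \o e2); split.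
  by apply: hdsum (prod_is_direct_sum P1 P2) => -[]; [exact: hPE K1 PE1|exact: hPE K2 PE2].
split.
  apply: pure_emb_comp p1 _; apply: (@pure_emb_retract _ _ _ _ (fun z => z.1 + g z.2)).
  - by move=> r x y; congr (_, _); rewrite /= fl // gl scalerBr opprD addrACA.
  - by move=> r x y /=; rewrite gl scalerDr addrACA.
  - by move=> x /=; rewrite subrK.
split.
  apply: pure_emb_comp p2 _; apply: (@pure_emb_retract _ _ _ _ snd) => //.
  by move=> r x y; congr (_, _); rewrite /= scaler0 addr0.
by split=> [m|]; rewrite /= /j1 /j2 ?fM ?gM ?fb ?gb' subrr.
Qed.

End GaloisTypes.

(** * Counting pp-types by instances of formulas *)

Section Counting.
Variables (R : pzRingType) (M : lmodType R).
Local Notation formula := (seq (seq (R * (nat + nat)))).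

Definition tcons (E : Type) (b : E) (z : nat -> E) (n : nat) : E :=
  if n is n'.+1 then z n' else b.

Definition instance_of (t : gtriple R M) (phi : formula) (w : nat -> M) : Prop :=
  sat phi (tcons (gb t) (gf t \o w)).

(* phi(0, w - w') determines phi(b, w) once phi(b, w') is known, so a single
   instance of each pp-formula determines the pp-type. *)
Lemma instance_transfer (t1 t2 : gtriple R M) phi (w w' : nat -> M) :
  pure_emb (gf t1) -> pure_emb (gf t2) ->
  instance_of t1 phi w' -> instance_of t2 phi w' ->
  instance_of t1 phi w -> instance_of t2 phi w.
Proof.
move=> [l1 [_ p1]] [l2 _] s1' s2' s1.
have tconsB (t : gtriple R M) : lin (gf t) ->
    (fun n => tcons (gb t) (gf t \o w') n - tcons (gb t) (gf t \o w) n) =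
    gf t \o tcons 0 (fun n => w' n - w n).
  move=> tl; apply: funext => -[|n] /=; first by rewrite subrr (lin0 tl).
  by rewrite (lin_sub tl).
have := sat_sub s1' s1; rewrite tconsB // => /(pure_sat p1) /(lin_sat l2).
rewrite -tconsB // => /(sat_sub s2'); congr sat; apply: funext => n.
by rewrite subKr.
Qed.

Lemma instance_same_pp_type (t1 t2 : gtriple R M) :
  (forall phi w, instance_of t1 phi w <-> instance_of t2 phi w) -> same_pp_type t1 t2.
Proof.
move=> tt psi u.
(* All variables standing for the point are identified with variable 0, and a parameter at [j] moves
   to [j.+1]. The filler 0 in [w] is never read through [r]. *)
pose r j := if u j is Some _ then j.+1 else 0%N.
pose w j := odflt 0 (u j).
have tE (t : gtriple R M) : point_tuple t \o u = tcons (gb t) (gf t \o w) \o r.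
  by apply: funext => j; rewrite /= /r; case uj : (u j) => [m|] //=; rewrite /w uj.
have [psi' psiE] := sat_reindex r psi.
by rewrite !tE -!psiE; exact: tt.
Qed.

End Counting.

Theorem theorem3p8 (R : pzRingType) (K : lmodType R -> Prop)
  (* (K, <=_p) is an AEC with LS(K) <= |Mu| *)
  (hiso : iso_closed K) (hchain : chain_closed K)
  (Mu : Type) (hMu : infinite_type Mu) (hLS : LS_property K Mu)
  (* closure properties *)
  (hdsum : dsum_closed K) (hPE : PE_closed K)
  (* the cardinal lambda = |L|, lambda >= LS(K), lambda^(|R|+aleph_0) = lambda *)
  (L : Type) (hMuL : exists c : Mu -> L, injective c)
  (hpow : exists F : ((R + nat)%type -> L) -> L, bijective F) :
  stable K L.
Proof.
move=> M KM [h /bij_inj hi].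
have [c ci] : exists c : nat -> L, injective c.
  case: hMu hMuL => [a ai] [b bi]; exists (b \o a); exact: inj_comp.
have eL : exponent_le L (R + nat).
  by case: hpow => F /bij_inj Fi; exists F.
have [F Fi] := exponent_le_formulas eL.
pose chosen (t : gtriple R M) phi (o : option (nat -> M)) : Prop :=
  if o is Some w then instance_of t phi w else forall w, ~ instance_of t phi w.
have /choice[W WP] (q : gtriple R M * seq (seq (R * (nat + nat)))) :
    exists o, chosen q.1 q.2 o.
  have [[w qw]|nq] := pselect (exists w, instance_of q.1 q.2 w).
    by exists (Some w).
  by exists None => w qw; apply: nq; exists w.
(* Coordinate 0 of the code tells whether the formula has an instance, by [c 0] or [c 1]; coordinate
   [n.+1] records the [n]-th parameter of the chosen instance. *)
exists (fun t => F (fun q => match W (t, q.1), q.2 with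
  | None, _ => c 0%N | Some _, 0%N => c 1%N | Some w, n.+1 => h (w n) end)).
move=> t1 t2 K1 p1 K2 p2 /Fi code_eq; apply: Relation_Operators.t_step.
apply: same_pp_type_gtpE => //; apply: instance_same_pp_type => phi w.
have Weq : W (t1, phi) = W (t2, phi).
  have codeE n := congr1 (fun f => f (phi, n)) code_eq; move: codeE => /=.
  case: (W _) => [w1|]; case: (W _) => [w2|] // codeE.
  - congr Some; apply: funext => n; exact/hi/(codeE n.+1).
  - by have /ci := codeE 0%N.
  - by have /ci := codeE 0%N.
(* Either both types have the instance [w'], which decides all others by [instance_transfer], or
   neither has any. *)
have := WP (t1, phi); have := WP (t2, phi); rewrite -Weq.
case: (W _) => [w'|] /= s2 s1; last by split=> [/s1|/s2].
by split; [exact: instance_transfer p1 p2 s1 s2|exact: instance_transfer p2 p1 s2 s1].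
Qed.
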